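(* Let $P$ be an irreducible, semi-isotropic transition matrix on $\mathrm{DL}(q,r)$, with projections $P_1$ on $\mathbb T^1$ and $P_2$ on $\mathbb T^2$. (a) Every minimal $P$-harmonic function $h$ on $\mathrm{DL}(q,r)$ is of the form $h(x_1x_2)=h_1(x_1)$ or $h(x_1x_2)=h_2(x_2)$, where $h_i$ is a minimal $P_i$-harmonic function on $\mathbb T^i$ ($i=1$ resp. $i=2$). (b) If $h$ is a positive $P$-harmonic function on $\mathrm{DL}(q,r)$, then there are non-negative $P_i$-harmonic functions $h_i$ on $\mathbb T^i$ ($i=1,2$) such that $h(x_1x_2)=h_1(x_1)+h_2(x_2)$ for all $x_1x_2\in\mathrm{DL}(q,r)$.
   Context: Tree notation: for $s\ge 2$, $\mathbb T_s$ is the homogeneous tree of degree $s+1$ with graph metric $d$. Fix an end $\omega$ and a root $o$. Each vertex $x$ has a unique neighbour $x^-$ (its predecessor) on the geodesic ray from $x$ to $\omega$. $\mathrm{hor}:\mathbb T_s\to\mathbb Z$ is defined by $\mathrm{hor}(o)=0$, $\mathrm{hor}(x)=\mathrm{hor}(x^-)+1$. The ancestors of $x$ are $x,x^-,(x^-)^-,\dots$; $x\curlywedge y$ is the common ancestor of $x,y$ with maximal $\mathrm{hor}$, and $\mathrm{up}(x,y)=\mathrm{hor}(x)-\mathrm{hor}(x\curlywedge y)$. DL-graphs: $\mathbb T^1=\mathbb T_q$, $\mathbb T^2=\mathbb T_r$ ($q,r\ge2$) with their own $\omega_i,o_i,\mathrm{hor},\mathrm{up}$. $\mathrm{DL}(q,r)=\{x_1x_2: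 x_i\in\mathbb T^i,\ \mathrm{hor}(x_1)+\mathrm{hor}(x_2)=0\}$, $x_1x_2\sim y_1y_2$ iff $x_1\sim y_1$ and $x_2\sim y_2$; root $o=o_1o_2$. $P$ is semi-isotropic if $p(x,y)=\mathfrak m\big(\mathrm{up}(x_1,y_1),\mathrm{up}(y_1,x_1),\mathrm{up}(x_2,y_2),\mathrm{up}(y_2,x_2)\big)$ for a probability measure $\mathfrak m$ on $\{(k_1,l_1,k_2,l_2)\in\mathbb N_0^4: k_1+k_2=l_1+l_2\}$. Projection: $p_1(x_1,y_1)=\sum_{y_2:\,y_1y_2\in\mathrm{DL}}p(x_1x_2,y_1y_2)$, independent of $x_2$; $P_2$ analogously. Harmonic: $h=Ph$. A positive harmonic function $h$ (on a state space with root $o$) is minimal if $h(o)=1$ and for every positive harmonic $h'$ with $h'\le h$ the ratio $h'/h$ is constant. *)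

(* Defs.v *)
From HB Require Import structures.
From mathcomp Require Import all_boot all_order all_algebra.
From mathcomp Require Import all_classical all_reals.
From mathcomp Require Import ereal esum.
Set Implicit Arguments. Unset Strict Implicit. Unset Printing Implicit Defensive.
Import Order.TTheory GRing.Theory Num.Theory.
Local Open Scope ring_scope.
Local Open Scope classical_set_scope.

(* Concrete model of the homogeneous tree T_s (degree s+1) with a fixed end  *)
(* omega, for s >= 2.  A vertex is a pair (n, c) : int * nat.  Reading c in  *)
(* base s, (n, c) is the vertex at horocycle level n whose "digits" at the   *)
(* levels n, n-1, n-2, ... are the base-s digits of c (all digits below some *)
(* level are 0).  The predecessor (the neighbour towards omega) is           *)
(* (n, c)^- = (n-1, c %/ s); the s successors of (n, c) are (n+1, c*s + a),  *)
(* a < s.  Every vertex thus has exactly one predecessor and s successors,   *)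
(* the graph x ~ y <-> (y = x^- or x = y^-) is a tree of degree s+1 and the  *)
(* rays x, x^-, x^-^-, ... all converge to one end omega.                    *)
(* The root is o = (0, 0) and hor (n, c) = n (so hor o = 0 and               *)
(* hor x = hor x^- + 1).                                                     *)
Definition vert := (int * nat)%type.

Definition tpred (s : nat) (x : vert) : vert := (x.1 - 1, (x.2 %/ s)%N).
Definition hor (x : vert) : int := x.1.
Definition troot : vert := (0, 0%N).
Definition tadj (s : nat) (x y : vert) : bool := (y == tpred s x) || (x == tpred s y).

Definition anc (s k : nat) (x : vert) : vert := iter k (tpred s) x.

(* [common s x y k] : the k-th ancestor of x is an ancestor of y
   (necessarily the (hor y - hor x + k)-th one). *)
Definition common (s : nat) (x y : vert) (k : nat) : bool :=
  (0 <= hor y - hor x + k%:Z) && (anc s k x == anc s (absz (hor y - hor x + k%:Z)) y).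

(* up(x,y) = hor x - hor (x meet y) = least k such that the k-th ancestor of x
   is a common ancestor of x and y.  For s >= 2 such a k exists and is at most
   x.2 + y.2 + |hor y - hor x| (then both ancestors have second coordinate 0
   and the same level), so a bounded search finds the least one. *)
Definition up (s : nat) (x y : vert) : nat :=
  find (common s x y) (iota 0 (x.2 + y.2 + absz (hor y - hor x)).+1).

Definition tmeet (s : nat) (x y : vert) : vert := anc s (up s x y) x.

(* We work with functions on vert * vert and restrict everything to DL.      *)
Definition inDL (x : vert * vert) : bool := hor x.1 + hor x.2 == 0.
Definition DLset : set (vert * vert) := [set x | inDL x].
Definition DLroot : vert * vert := (troot, troot).
Definition DLadj (q r : nat) (x y : vert * vert) : bool :=
  tadj q x.1 y.1 && tadj r x.2 y.2.

Definition transition_matrix (R : realType) (V : choiceType) (S : set V)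
  (p : V -> V -> R) : Prop :=
  (forall x y, S x -> S y -> 0 <= p x y) /\
  (forall x, S x -> \esum_(y in S) (p x y)%:E = 1%E).

Definition irreducible (R : realType) (V : choiceType) (S : set V)
  (p : V -> V -> R) : Prop :=
  forall x y, S x -> S y ->
    exists zs : seq V, [/\ all (fun z => `[< S z >]) zs,
                           path (fun a b => 0 < p a b) x zs & last x zs = y].

Definition semi_isotropic (R : realType) (q r : nat)
  (p : vert * vert -> vert * vert -> R) : Prop :=
  exists m : nat -> nat -> nat -> nat -> R,
    (forall k1 l1 k2 l2, 0 <= m k1 l1 k2 l2) /\
    (forall k1 l1 k2 l2, (k1 + k2 != l1 + l2)%N -> m k1 l1 k2 l2 = 0) /\
    (forall x y, inDL x -> inDL y ->
       p x y = m (up q x.1 y.1) (up q y.1 x.1) (up r x.2 y.2) (up r y.2 x.2)).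

(* Projections.  p1(x1,y1) = sum_{y2 : y1y2 in DL} p(x1x2, y1y2), computed with
   the particular choice x2 = (-hor x1, 0) (the paper shows the value does not
   depend on x2 with x1x2 in DL).  Analogously for p2. *)
Definition proj1 (R : realType) (p : vert * vert -> vert * vert -> R)
  (x1 y1 : vert) : R :=
  fine (\esum_(y2 in [set y2 : vert | hor y1 + hor y2 = 0])
          (p (x1, (- hor x1, 0%N)) (y1, y2))%:E).
Definition proj2 (R : realType) (p : vert * vert -> vert * vert -> R)
  (x2 y2 : vert) : R :=
  fine (\esum_(y1 in [set y1 : vert | hor y1 + hor y2 = 0])
          (p ((- hor x2, 0%N), x2) (y1, y2))%:E).

Definition nonneg_harmonic (R : realType) (V : choiceType) (S : set V)
  (p : V -> V -> R) (h : V -> R) : Prop :=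
  (forall x, S x -> 0 <= h x) /\
  (forall x, S x -> (h x)%:E = \esum_(y in S) (p x y * h y)%:E).

Definition positive_harmonic (R : realType) (V : choiceType) (S : set V)
  (p : V -> V -> R) (h : V -> R) : Prop :=
  nonneg_harmonic S p h /\ (forall x, S x -> 0 < h x).

Definition minimal_harmonic (R : realType) (V : choiceType) (S : set V)
  (p : V -> V -> R) (o : V) (h : V -> R) : Prop :=
  [/\ positive_harmonic S p h, h o = 1 &
      forall h' : V -> R, positive_harmonic S p h' ->
        (forall x, S x -> h' x <= h x) ->
        exists c : R, forall x, S x -> h' x = c * h x].

(* Main.v *)
Require Import Defs.
From HB Require Import structures.
From mathcomp Require Import all_boot all_order all_algebra.
From mathcomp Require Import all_classical all_reals.
From mathcomp Require Import ereal esum.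
From mathcomp Require Import zify.
Set Implicit Arguments. Unset Strict Implicit. Unset Printing Implicit Defensive.
Import Order.TTheory GRing.Theory Num.Theory.
Local Open Scope ring_scope.
Local Open Scope classical_set_scope.

(* Let A_n (resp. B_n) be the set of x1x2 such that x2 (resp. x1) lies outside
   the cone below the n-th ancestor of the root; the complement of A_n `|` B_n
   is finite.  A positive harmonic h is split as a + b, where a is below the
   balayage r_n of h on every A_n, and b is the least superharmonic function
   above all h - r_n.  Since h is bounded by a multiple of r_n on the finite
   remainder, b equals its own balayage on every B_n, and likewise a on A_n.
   An exchange of two sibling subtrees of the second tree below the n-th
   ancestor of the root leaves P invariant and fixes A_n pointwise, hence fixes
   a.  So a is a function of x1, and similarly b is a function of x2.  For a
   minimal h both summands are multiples of h.  Only monotonicity and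
   additivity of P are used: infima of superharmonic functions replace limits
   and integral representations. *)

(** * Extended sums: scaling and reindexing *)

Lemma le_esumZl (R : realType) (T : choiceType) (I : set T) (a : T -> R) (c : R) :
  0 <= c ->
  (\esum_(i in I) (c * a i)%:E <= c%:E * \esum_(i in I) (a i)%:E)%E.
Proof.
move=> c0; apply: ge_ereal_sup => _ [X [finX XI] <-].
rewrite fsumEFin// fsbig_finite//= -mulr_sumr EFinM; apply: lee_wpmul2l.
  by rewrite lee_fin.
by rewrite -fsbig_finite//= -fsumEFin//; apply: ereal_sup_ubound; exists X.
Qed.

(** The reverse inequality is the previous one for the factor [c^-1]; only [c = 0] needs a separate
    argument. *)
Lemma esumZl (R : realType) (T : choiceType) (I : set T) (a : T -> R) (c : R) :
  0 <= c ->
  (\esum_(i in I) (c * a i)%:E = c%:E * \esum_(i in I) (a i)%:E)%E.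
Proof.
move=> c0; apply/eqP; rewrite eq_le le_esumZl//=.
case: (eqVneq c 0) => [->|cn0]; first by rewrite mul0e esum_ge0// => x _; rewrite mul0r.
have c0' : 0 < c by rewrite lt_neqAle eq_sym cn0.
rewrite -lee_pdivlMl//.
rewrite (eq_esum (b := fun i => (c^-1 * (c * a i))%:E)); last first.
  by move=> i _; rewrite mulKf.
by apply: le_esumZl; rewrite invr_ge0.
Qed.

Lemma esum_involution (R : realType) (T : choiceType) (S : set T) (t : T -> T)
    (a : T -> \bar R) : (forall x, S x -> S (t x)) -> involutive t ->
  \esum_(x in S) a x = \esum_(x in S) a (t x).
Proof.
move=> tS tK; apply: reindex_esum; split=> //.
  by move=> x y _ _ /(congr1 t); rewrite !tK.
by move=> y Sy; exists (t y); rewrite ?tK//; exact: tS.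
Qed.

(** * Superharmonic functions and balayage *)

Section Superharmonic.
Variables (R : realType) (V : choiceType) (S : set V) (p : V -> V -> R).
Hypothesis p_ge0 : forall x y, S x -> S y -> 0 <= p x y.

Implicit Types (u w h : V -> R) (A B : set V).

Local Notation "u <=S w" := (forall x, S x -> u x <= w x) (at level 70).

(** The function Pu, with values in the extended reals because the sum may diverge. *)
Definition avg u x : \bar R := \esum_(y in S) (p x y * u y)%:E.

Definition superharmonic u := (forall x, S x -> 0 <= u x) /\
  (forall x, S x -> (avg u x <= (u x)%:E)%E).

Lemma avg_ge0 u x : S x -> (forall y, S y -> 0 <= u y) -> (0 <= avg u x)%E.
Proof.
by move=> Sx u0; apply: esum_ge0 => y Sy; rewrite lee_fin mulr_ge0 ?p_ge0 ?u0.
Qed.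

Lemma le_avg u w x : S x -> u <=S w -> (avg u x <= avg w x)%E.
Proof.
by move=> Sx uw; apply: le_esum => y Sy; rewrite lee_fin ler_wpM2l ?p_ge0 ?uw.
Qed.

Lemma eq_avg u w x : (forall y, S y -> u y = w y) -> avg u x = avg w x.
Proof. by move=> uw; apply: eq_esum => y Sy; rewrite uw. Qed.

Lemma avgD u w x : S x -> (forall y, S y -> 0 <= u y) ->
  (forall y, S y -> 0 <= w y) ->
  avg (fun y => u y + w y) x = (avg u x + avg w x)%E.
Proof.
move=> Sx u0 w0; rewrite /avg -esumD.
- by apply: eq_esum => y Sy; rewrite mulrDr EFinD.
- by move=> y Sy; rewrite lee_fin mulr_ge0 ?p_ge0 ?u0.
- by move=> y Sy; rewrite lee_fin mulr_ge0 ?p_ge0 ?w0.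
Qed.

Lemma avgZ u x c : 0 <= c -> avg (fun y => c * u y) x = (c%:E * avg u x)%E.
Proof.
by move=> c0; rewrite -esumZl//; apply: eq_esum => y _; rewrite mulrCA.
Qed.

Lemma harmonic_superharmonic h : nonneg_harmonic S p h -> superharmonic h.
Proof. by case=> h0 hP; split=> // x Sx; rewrite hP. Qed.

Lemma superharmonicD u w : superharmonic u -> superharmonic w ->
  superharmonic (fun x => u x + w x).
Proof.
move=> [u0 uP] [w0 wP]; split=> x Sx; first by rewrite addr_ge0 ?u0 ?w0.
by rewrite avgD// EFinD leeD ?uP ?wP.
Qed.

Lemma superharmonicZ u c : 0 <= c -> superharmonic u ->
  superharmonic (fun x => c * u x).
Proof.
move=> c0 [u0 uP]; split=> x Sx; first by rewrite mulr_ge0 ?u0.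
by rewrite avgZ// EFinM lee_wpmul2l ?lee_fin ?uP.
Qed.

Lemma superharmonic_fin u x : superharmonic u -> S x -> avg u x \is a fin_num.
Proof.
move=> [u0 uP] Sx; rewrite ge0_fin_numE ?avg_ge0//.
exact: le_lt_trans (uP x Sx) (ltry _).
Qed.

Lemma superharmonicB u h : superharmonic u -> nonneg_harmonic S p h ->
  h <=S u -> superharmonic (fun x => u x - h x).
Proof.
move=> [u0 uP] [h0 hP] hu; split=> x Sx; first by rewrite subr_ge0 hu.
rewrite EFinB leeBrDl// [X in (X + _)%E]hP// -avgD//.
  by rewrite (eq_avg (w := u)) ?uP// => y _; rewrite addrC subrK.
by move=> y Sy; rewrite subr_ge0 hu.
Qed.

Lemma harmonicB u h : nonneg_harmonic S p u -> nonneg_harmonic S p h ->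
  h <=S u -> nonneg_harmonic S p (fun x => u x - h x).
Proof.
move=> [u0 uP] [h0 hP] hu; split=> x Sx; first by rewrite subr_ge0 hu.
have d0 y : S y -> 0 <= u y - h y by move=> Sy; rewrite subr_ge0 hu.
rewrite -/(avg _ _) EFinB uP// -/(avg _ _) (eq_avg (w := fun y => h y + (u y - h y))).
  rewrite avgD// (_ : avg h x = (h x)%:E); last by rewrite hP.
  by rewrite addeAC subee ?add0e.
by move=> y _; rewrite addrC subrK.
Qed.

Lemma superharmonic_avg u : superharmonic u -> superharmonic (fine \o avg u).
Proof.
move=> su; case: (su) => u0 uP; split=> x Sx /=; first by rewrite fine_ge0// avg_ge0.
rewrite fineK ?superharmonic_fin//; apply: le_avg => // y Sy /=.
by rewrite -lee_fin fineK ?superharmonic_fin ?uP.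
Qed.

(** The infimum is taken in the reals; on [S] it is a genuine one for every nonempty family of
    superharmonic functions, these being bounded below by 0. *)
Definition infl (F : set (V -> R)) x := inf [set u x | u in F].

Section Infimum.
Variable F : set (V -> R).
Hypotheses (F0 : F !=set0) (FS : F `<=` superharmonic).

Lemma infl_le u : F u -> infl F <=S u.
Proof.
move=> Fu x Sx; apply: ge_inf; last by exists u.
by exists 0 => _ [w /FS[w0 _] <-]; exact: w0.
Qed.

Lemma le_infl c x : (forall u, F u -> c <= u x) -> c <= infl F x.
Proof.
move=> Fc; apply: lb_le_inf => [|_ [u Fu <-]]; last exact: Fc.
by case: F0 => u Fu; exists (u x), u.
Qed.

Lemma superharmonic_infl : superharmonic (infl F).
Proof.
have i0 x : S x -> 0 <= infl F x.
  by move=> Sx; apply: le_infl => u /FS[u0 _]; exact: u0.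
split=> // x Sx.
have le u : F u -> (avg (infl F) x <= (u x)%:E)%E.
  move=> Fu; have [_ uP] := FS Fu; apply: le_trans (uP x Sx).
  by apply: le_avg => //; exact: infl_le.
have fin : avg (infl F) x \is a fin_num.
  case: F0 => u Fu; rewrite ge0_fin_numE ?avg_ge0//.
  exact: le_lt_trans (le u Fu) (ltry _).
rewrite -(fineK fin) lee_fin; apply: le_infl => u Fu.
by rewrite -lee_fin fineK ?le.
Qed.

(** The infimum v is superharmonic, so Pv <= v; if Pv belongs to the family, then also v <= Pv. *)
Lemma harmonic_infl : F (fine \o avg (infl F)) -> nonneg_harmonic S p (infl F).
Proof.
move=> FP; have [i0 iP] := superharmonic_infl; split=> // x Sx.
apply/eqP; rewrite eq_le [X in _ && X]iP// andbT.
have := infl_le FP Sx; rewrite -lee_fin /= fineK//.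
exact: superharmonic_fin superharmonic_infl Sx.
Qed.
End Infimum.

(** Take for [b] the infimum of all superharmonic s with h <= s + w for every w in [W]. This class
    contains Pb, because Pb + w >= Pb + Pw = P(b + w) >= Ph = h; hence [b] is harmonic. *)
Lemma least_complement h (W : set (V -> R)) :
  nonneg_harmonic S p h -> W `<=` superharmonic ->
  exists b, [/\ nonneg_harmonic S p b, b <=S h,
    forall w, W w -> h <=S (fun x => b x + w x) &
    forall s, superharmonic s ->
      (forall w, W w -> h <=S (fun x => s x + w x)) -> b <=S s].
Proof.
move=> hh WS.
pose F : set (V -> R) := [set s | superharmonic s /\
  forall w, W w -> h <=S (fun x => s x + w x)].
have FS : F `<=` superharmonic by move=> s [].
have Fh : F h.
  split=> [|w /WS[w0 _] x Sx]; first exact: harmonic_superharmonic.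
  by rewrite lerDl w0.
have F0 : F !=set0 by exists h.
have si := superharmonic_infl F0 FS.
have Fi w : W w -> h <=S (fun x => infl F x + w x).
  move=> Ww x Sx; rewrite -lerBlDr; apply: le_infl => // u [_ uW].
  by rewrite lerBlDr uW.
exists (infl F); split=> //.
- apply: harmonic_infl => //; split; first exact: superharmonic_avg.
  move=> w Ww x Sx; have sw := WS _ Ww; rewrite -lee_fin EFinD fineK; last first.
    exact: superharmonic_fin.
  case: hh => h0 hP; rewrite hP//; case: (sw) => w0 wP; case: (si) => i0 _.
  apply: (@le_trans _ _ (avg (infl F) x + avg w x)%E); last by rewrite leeD2l// wP.
  by rewrite -avgD// le_avg// => y Sy; exact: Fi.
- exact: infl_le.
- by move=> s ss sW; apply: infl_le.
Qed.

(* For harmonic [u] this says that the balayage of [u] on [A] is [u]. *)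
Definition carried A u := forall w, superharmonic w ->
  (forall x, S x -> A x -> u x <= w x) -> u <=S w.

Lemma carriedZ A u c : 0 < c -> carried A u -> carried A (fun x => c * u x).
Proof.
move=> c0 cu w sw uw x Sx; rewrite -ler_pdivlMl//.
apply: (cu (fun y => c^-1 * w y)) => // [|y Sy Ay].
  by apply: superharmonicZ => //; rewrite invr_ge0 ltW.
by rewrite ler_pdivlMl ?uw.
Qed.

(** If w >= h on [A], then w + (u - h) is superharmonic and at least u on [A], hence everywhere;
    cancelling u leaves w >= h. *)
Lemma carried_le A u h : carried A u -> superharmonic u ->
  nonneg_harmonic S p h -> h <=S u -> carried A h.
Proof.
move=> cu su hh hu w sw hw x Sx; have sd := superharmonicB su hh hu.
have := cu _ (superharmonicD sw sd) _ x Sx.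
rewrite addrCA lerDl subr_ge0; apply => y Sy Ay /=.
by rewrite addrCA lerDl subr_ge0 hw.
Qed.

Lemma balayage A h : superharmonic h -> exists u, [/\ superharmonic u,
  carried A u, u <=S h, (forall x, S x -> A x -> u x = h x) &
  forall w, superharmonic w -> (forall x, S x -> A x -> h x <= w x) -> u <=S w].
Proof.
move=> sh.
pose F : set (V -> R) := [set s | superharmonic s /\
  forall x, S x -> A x -> h x <= s x].
have FS : F `<=` superharmonic by move=> s [].
have Fh : F h by [].
have F0 : F !=set0 by exists h.
have Ah x : S x -> A x -> h x <= infl F x.
  by move=> Sx Ax; apply: le_infl => // u [_]; exact.
exists (infl F); split.
- exact: superharmonic_infl.
- move=> w sw iw; apply: infl_le => //; split=> // x Sx Ax.
  exact: le_trans (Ah x Sx Ax) (iw x Sx Ax).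
- exact: infl_le.
- by move=> x Sx Ax; apply/eqP; rewrite eq_le Ah ?andbT ?infl_le.
- by move=> w sw hw; apply: infl_le.
Qed.

(** The function [u \o t] is superharmonic and agrees with [u] on [A], so it dominates [u];
    evaluating this at [t x] gives the reverse inequality. *)
Lemma carried_invariant A u (t : V -> V) : superharmonic u -> carried A u ->
  (forall x, S x -> S (t x)) -> involutive t ->
  (forall x y, S x -> S y -> p (t x) (t y) = p x y) ->
  (forall x, S x -> A x -> t x = x) -> forall x, S x -> u (t x) = u x.
Proof.
move=> su cu tS tK tp tA.
have st : superharmonic (u \o t).
  case: su => u0 uP; split=> x Sx /=; first exact/u0/tS.
  apply: le_trans (uP _ (tS _ Sx)).
  rewrite [leRHS]/avg (esum_involution _ tS tK).
  by apply: le_esum => y Sy; rewrite tp.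
have le : u <=S u \o t by apply: cu => // x Sx Ax /=; rewrite tA.
move=> x Sx; apply/eqP; rewrite eq_le [X in _ && X]le// andbT.
by have := le _ (tS _ Sx); rewrite /= tK.
Qed.

(** Positivity travels backwards along a path of positive transitions: u(x) >= p(x,z) u(z). *)
Lemma superharmonic_gt0 u y : irreducible S p -> superharmonic u ->
  S y -> 0 < u y -> forall x, S x -> 0 < u x.
Proof.
move=> irr [u0 uP] Sy uy x Sx; have [zs [Szs pzs lzs]] := irr x y Sx Sy.
elim: zs x Sx Szs pzs lzs => [x _ _ _ /= ->//|z zs IH x Sx /= /andP[/asboolP Sz Szs]].
move=> /andP[pxz pzs] lzs; have uz := IH z Sz Szs pzs lzs.
rewrite -lte_fin; apply: lt_le_trans (uP x Sx).
apply: (@lt_le_trans _ _ (p x z * u z)%:E); first by rewrite lte_fin mulr_gt0.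
apply: esum_ge; exists [set z]; first by split=> // _ ->.
by rewrite fsbig_set1.
Qed.

(** * Splitting a positive harmonic function *)

Lemma harmonic_decomposition h (A B : nat -> set V) :
  irreducible S p -> positive_harmonic S p h ->
  (forall m n, (m <= n)%N -> A n `<=` A m) ->
  (forall m n, (m <= n)%N -> B n `<=` B m) ->
  (forall n, (S `&` A n) !=set0) ->
  (forall n, exists s : seq V, forall x, S x -> ~ A n x -> ~ B n x -> x \in s) ->
  exists a b, [/\ nonneg_harmonic S p a, nonneg_harmonic S p b,
    forall x, S x -> h x = a x + b x, forall n, carried (A n) a &
    forall n, carried (B n) b].
Proof.
move=> irr [hh hpos] decA decB A0 fin.
have sh := harmonic_superharmonic hh.
have /choice[r rP] n := balayage (A n) sh.
pose W : set (V -> R) := range r.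
have WS : W `<=` superharmonic by move=> _ [n _ <-]; case: (rP n).
have [b [hb bh bW bmin]] := least_complement hh WS.
have ha := harmonicB hh hb bh.
have sb := harmonic_superharmonic hb.
exists (fun x => h x - b x), b; split=> //.
- by move=> x Sx; rewrite subrK.
- move=> n; have [sr cr _ _ _] := rP n; apply: (carried_le cr sr ha) => x Sx.
  by rewrite lerBlDl bW//; exists n.
(* By minimality of [b] it is enough to bound h by w + r_n0 for each n0. Enlarging n0 to [n] only
   decreases the balayage, and [B n] lies in [B m], so a single index serves both families. *)
move=> m w sw bw; apply: bmin => // _ [n0 _ <-].
pose n := maxn m n0.
suff wr : h <=S (fun x => w x + r n x).
  move=> x Sx; apply: le_trans (wr x Sx) _; rewrite lerD2l.
  have [_ _ _ _ rmin] := rP n; have [sr0 _ _ rA _] := rP n0.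
  apply: rmin => // y Sy Ay; rewrite rA//.
  by apply: decA Ay; rewrite leq_maxr.
have {}bw x : S x -> B n x -> b x <= w x.
  by move=> Sx Bx; apply: bw => //; apply: decB Bx; rewrite leq_maxl.
have [sr cr rh rA rmin] := rP n.
have [q [sq cq qh qB qmin]] := balayage (B n) sh.
have rpos x : S x -> 0 < r n x.
  have [y [Sy Ay]] := A0 n; apply: (superharmonic_gt0 irr sr Sy).
  by rewrite rA// hpos.
(* On the finite set missed by [A n] and [B n], [h] is at most a multiple of [r n]. *)
have [c [c1 hc]] : exists c, 1 <= c /\ h <=S (fun x => q x + c * r n x).
  have [s sP] := fin n; pose g x := h x / r n x.
  have g0 x : S x -> 0 <= g x by move=> Sx; rewrite ltW// divr_gt0 ?rpos ?hpos.
  (* The list may contain points outside [S], where [g] has no known sign; these contribute 0. The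
     summand 1 secures [1 <= c]. *)
  pose c := 1 + \sum_(x <- undup s) (if `[< S x >] then g x else 0).
  have t0 x : 0 <= (if `[< S x >] then g x else 0) by case: asboolP => // /g0.
  have c1 : 1 <= c by rewrite lerDl sumr_ge0.
  have c0 : 0 <= c by rewrite (le_trans _ c1).
  have [r0 _] := sr; have [q0 _] := sq.
  exists c; split=> // x Sx.
  have [Ax|nA] := pselect (A n x).
    by rewrite -rA// -[leLHS]add0r lerD ?q0// ler_peMl// r0.
  have [Bx|nB] := pselect (B n x).
    by rewrite -qB// lerDl mulr_ge0 ?r0.
  rewrite -[leLHS]add0r lerD ?q0// -ler_pdivrMr ?rpos// -/(g x).
  have xs : x \in undup s by rewrite mem_undup sP.
  rewrite /c (big_rem x xs)/=; case: asboolP => //_.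
  by rewrite addrCA lerDl addr_ge0// sumr_ge0.
have c0 : 0 < c by rewrite (lt_le_trans _ c1).
have sc := superharmonicZ (ltW c0) sr.
(* A second complement, now relative to c r_n. Its [b'] is below [q], hence carried by [B n], and
   below [b], hence below [w]. The remainder h - b' is below c r_n, hence carried by [A n], where
   r_n = h dominates it; so h - b' <= r_n with the factor [c] removed. *)
have Wc : [set (fun x => c * r n x)] `<=` superharmonic by move=> _ ->.
have [b' [hb' b'h b'W b'min]] := least_complement hh Wc.
have cb' : carried (B n) b'.
  by apply: (carried_le cq) => //; apply: b'min => // _ ->.
have ha' := harmonicB hh hb' b'h.
have ca' : carried (A n) (fun x => h x - b' x).
  apply: (carried_le (carriedZ c0 cr)) => // x Sx.
  by rewrite lerBlDl; exact: (b'W _ erefl).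
have a'r : (fun x => h x - b' x) <=S r n.
  apply: ca' => // x Sx Ax; rewrite rA// gerBl.
  by case: hb' => + _; exact.
have b'b : b' <=S b.
  apply: b'min => // _ -> x Sx; apply: le_trans (bW (r n) _ x Sx) _; first by exists n.
  by rewrite lerD2l ler_peMl// ltW ?rpos.
have b'w : b' <=S w.
  by apply: cb' => // x Sx Bx; apply: le_trans (b'b x Sx) (bw x Sx Bx).
move=> x Sx; have := a'r x Sx; rewrite lerBlDl => /le_trans; apply.
by rewrite lerD2r b'w.
Qed.

End Superharmonic.

(** * Symmetries of the tree *)

Lemma ancE s k x : anc s k x = (x.1 - k%:Z, (x.2 %/ s ^ k)%N).
Proof.
elim: k => [|k IH]; first by rewrite /anc /= subr0 divn1; case: x.
rewrite /anc iterS -/(anc s k x) IH /tpred /= -divnMA -expnSr; congr pair; lia.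
Qed.

(** Since s^k > k, this many steps up bring both second coordinates to 0. *)
Lemma common_large s x y : (2 <= s)%N ->
  common s x y (x.2 + y.2 + absz (hor y - hor x)%R).
Proof.
case: x y => [m c] [n d] s2; rewrite /common /hor !ancE /=.
have big a k : (a <= k)%N -> (a %/ s ^ k = 0)%N.
  by move=> ak; rewrite divn_small// (leq_ltn_trans ak)// ltn_expl.
apply/andP; split; first by lia.
apply/eqP; rewrite !big; [congr pair; lia| lia | lia].
Qed.

(** The search bound in [up] depends on second coordinates, which a symmetry changes; the search
    result does not depend on the bound once it is large enough. *)
Lemma eq_find_iota (P : pred nat) m n :
  P m -> P n -> find P (iota 0 m.+1) = find P (iota 0 n.+1).
Proof.
wlog mn : m n / (m <= n)%N.
  by move=> H Pm Pn; case/orP: (leq_total m n) => ?; [|apply/esym]; exact: H.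
move=> Pm _; rewrite -(subnKC mn) -addSn iotaD find_cat ifT //.
by apply/hasP; exists m => //; rewrite mem_iota leq0n add0n ltnSn.
Qed.

(** Automorphisms of order at most two that fix the end and map each horocycle to itself. *)
Definition tree_involution s (g : vert -> vert) :=
  [/\ involutive g, forall x, hor (g x) = hor x &
      forall x, tpred s (g x) = g (tpred s x)].

Lemma up_involution s g x y : (2 <= s)%N -> tree_involution s g ->
  up s (g x) (g y) = up s x y.
Proof.
move=> s2 [gK gh gp].
have ga k z : anc s k (g z) = g (anc s k z).
  by elim: k => // k IH; rewrite /anc !iterS -!/(anc _ _ _) IH gp.
have ge : common s (g x) (g y) =1 common s x y.
  by move=> k; rewrite /common !gh !ga (inj_eq (inv_inj gK)).
rewrite /up (eq_find ge); apply: eq_find_iota; last exact: common_large.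
by rewrite -ge common_large.
Qed.

Definition swapn (c d e : nat) := if e == c then d else if e == d then c else e.

(* Exchanges the subtrees below the siblings [(n, c)] and [(n, d)]. *)
Definition swap_subtrees s (n : int) (c d : nat) (y : vert) : vert :=
  if n <= y.1 then
    let k := (s ^ absz (y.1 - n)%R)%N in
    (y.1, (swapn c d (y.2 %/ k) * k + y.2 %% k)%N)
  else y.

Lemma swapnK c d : involutive (swapn c d).
Proof.
move=> e; rewrite /swapn; case: (eqVneq e c) => [->|ec].
  by rewrite eqxx; case: eqVneq.
by case: (eqVneq e d) => [->|ed]; rewrite ?eqxx// (negPf ec) (negPf ed).
Qed.

Lemma swap_subtrees_involution s n c d : (2 <= s)%N -> (c %/ s = d %/ s)%N ->
  tree_involution s (swap_subtrees s n c d).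
Proof.
move=> s2 cd; have s0 k : (0 < s ^ k)%N by rewrite expn_gt0; lia.
split=> [[m e]|[m e]|[m e]]; rewrite /swap_subtrees /hor /tpred /=.
- case nm: (n <= m) => /=; rewrite nm //.
  congr pair; rewrite divnMDl// modnMDl modn_mod.
  by rewrite [(_ %% _ %/ _)%N]divn_small ?ltn_mod// addn0 swapnK -divn_eq.
- by case: ifP.
(* At levels greater than [n], passing to the predecessor only drops the last digit of the
   remainder. At level [n] the predecessor is no longer moved, and siblings share it. At smaller
   levels the map is the identity. *)
have [nm|nm] := ltP n m.
  rewrite (ltW nm) ifT /=; last by lia.
  have -> : absz (m - n)%R = (absz (m - 1 - n)%R).+1 by lia.
  set j := absz _; congr pair; rewrite expnS divnMA [(_ * (_ * _))%N]mulnCA mulnC.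
  by rewrite divnMDl; [rewrite mulnC modn_divl [(s * _)%N]mulnC|lia].
have [nm'|nm'] := leP n (m - 1); first by lia.
have [mn|mn] := leP n m => //.
have -> : absz (m - n)%R = 0%N by lia.
rewrite expn0 divn1 modn1 addn0 muln1; congr pair.
by rewrite /swapn; case: eqVneq => [->//|_]; case: eqVneq => [->|].
Qed.

(** The descendants of (-n, 0), the n-th ancestor of the root: the bound on the second coordinate
    says that the ancestor at level -n has second coordinate 0. *)
Definition cone s (n : nat) (x : vert) : bool :=
  (- n%:Z <= x.1) && (x.2 < s ^ absz (x.1 + n%:Z)%R)%N.

Lemma cone_mono s m n x : (2 <= s)%N -> (m <= n)%N -> cone s m x -> cone s n x.
Proof.
move=> s2 mn /andP[h1 h2]; rewrite /cone; apply/andP; split; first by lia.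
by apply: (leq_trans h2); rewrite leq_exp2l//; lia.
Qed.

(** If [y] has level at least [n] and lies outside the cone, its ancestor at level [n] has second
    coordinate at least s^(n+k), which exceeds [c] and [d]; so [y] is below neither sibling. *)
Lemma swap_subtrees_id s n c d k y : (2 <= s)%N -> cone s k (n, c) ->
  cone s k (n, d) -> ~~ cone s k y -> swap_subtrees s n c d y = y.
Proof.
case: y => m e s2 /andP[/= kn c_lt] /andP[/= _ d_lt].
rewrite /cone /swap_subtrees /=; case: ifPn => // nm.
have -> /= : - k%:Z <= m by lia.
set j := absz (m - n)%R.
have -> : (s ^ absz (m + k%:Z)%R = s ^ absz (n + k%:Z)%R * s ^ j)%N.
  by rewrite -expnD; congr expn; rewrite /j; lia.
rewrite -leqNgt => le_e; congr pair.
have : (s ^ absz (n + k%:Z)%R <= e %/ s ^ j)%N.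
  by rewrite leq_divRL ?expn_gt0; lia.
rewrite /swapn => le_q; rewrite !ifN; [by rewrite -divn_eq|lia|lia].
Qed.

Lemma mem_cone s x : (2 <= s)%N -> cone s (absz x.1 + x.2) x.
Proof.
move=> s2; rewrite /cone; apply/andP; split; first by lia.
by apply: (@leq_ltn_trans (absz (x.1 + (absz x.1 + x.2)%N%:Z)%R)); [lia|rewrite ltn_expl].
Qed.

(** If two vertices share their (k+1)-th ancestor, their k-th ancestors are siblings or equal, and
    exchanging these brings the first vertex below the k-th ancestor of the second. Induction on k
    then reaches the whole horocycle. *)
Lemma horocycle_constant (T : Type) s (f : vert -> T) (m : int) : (2 <= s)%N ->
  (forall n c d y, hor y = m -> (c %/ s = d %/ s)%N ->
     f (swap_subtrees s n c d y) = f y) ->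
  forall x y, hor x = m -> hor y = m -> f x = f y.
Proof.
move=> s2 fP [m1 c] [m2 d]; rewrite /hor /= => -> -> {m1 m2}.
have s0 k : (0 < s ^ k)%N by rewrite expn_gt0; lia.
have step k : forall c d, (c %/ s ^ k = d %/ s ^ k)%N -> f (m, c) = f (m, d).
  elim: k => [|k IH] {}c {}d; first by rewrite !divn1 => ->.
  rewrite expnSr !divnMA => cd; rewrite -(fP (m - k%:Z) _ _ (m, c) erefl cd).
  rewrite /swap_subtrees /= ifT; last by lia.
  have -> : absz (m - (m - k%:Z))%R = k by lia.
  apply: IH; rewrite /swapn eqxx divnMDl//.
  by rewrite [(_ %% _ %/ _)%N]divn_small ?ltn_mod// addn0.
(* Since s^(c+d) > c + d, the two ancestors at this height coincide. *)
apply: (step (c + d)%N); rewrite !divn_small//.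
  by apply: leq_ltn_trans (ltn_expl _ s2); lia.
by apply: leq_ltn_trans (ltn_expl _ s2); lia.
Qed.

(** * Harmonic functions on the horocyclic product *)

Section DiestelLeader.
Variables (R : realType) (q r : nat) (p : vert * vert -> vert * vert -> R).
Hypotheses (q2 : (2 <= q)%N) (r2 : (2 <= r)%N).
Hypotheses (tm : transition_matrix DLset p) (si : semi_isotropic q r p).

(** The entries of P depend only on the four [up] values, which both factors preserve. *)
Lemma DL_involution g1 g2 : tree_involution q g1 -> tree_involution r g2 ->
  let t := fun x : vert * vert => (g1 x.1, g2 x.2) in
  [/\ forall x, DLset x -> DLset (t x), involutive t &
      forall x y, DLset x -> DLset y -> p (t x) (t y) = p x y].
Proof.
move=> i1 i2 /=; have [g1K g1h _] := i1; have [g2K g2h _] := i2.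
have tD x : DLset x -> DLset (g1 x.1, g2 x.2) by rewrite /DLset /= /inDL /= g1h g2h.
split=> // [[x1 x2]|x y Dx Dy]; first by rewrite /= g1K g2K.
have [m [_ [_ mP]]] := si.
by rewrite !mP//= ?(up_involution _ _ q2 i1) ?(up_involution _ _ r2 i2)//; exact: tD.
Qed.

Lemma id_involution s : tree_involution s id. Proof. by []. Qed.

Lemma cone_complement_invariant2 u : superharmonic DLset p u ->
  (forall n, carried DLset p [set x | ~~ cone r n x.2] u) ->
  forall x y, inDL x -> inDL y -> x.1 = y.1 -> u x = u y.
Proof.
move=> su cu [x1 x2] [y1 y2]; rewrite /inDL /= => Dx + e; rewrite -{}e => Dy.
apply: (@horocycle_constant _ r (fun z => u (x1, z)) (- hor x1)) => //.
- move=> n c d y hy cd; have i2 := swap_subtrees_involution n r2 cd.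
  have [tD tK tp] := DL_involution (id_involution q) i2.
  (* The index is large enough for the cone to contain both siblings [(n, c)] and [(n, d)], so the
     exchange fixes its complement. *)
  have inv := carried_invariant su (cu (absz n + c + d)%N) tD tK tp; apply: (inv _ (x1, y)).
    move=> [z1 z2] Dz /= nc; congr pair; apply: swap_subtrees_id nc => //.
      by apply: (cone_mono r2 _ (mem_cone (n, c) r2)) => /=; lia.
    by apply: (cone_mono r2 _ (mem_cone (n, d) r2)) => /=; lia.
  by rewrite /DLset /= /inDL /= hy subrr.
- by lia.
- by lia.
Qed.

Lemma cone_complement_invariant1 u : superharmonic DLset p u ->
  (forall n, carried DLset p [set x | ~~ cone q n x.1] u) ->
  forall x y, inDL x -> inDL y -> x.2 = y.2 -> u x = u y.
Proof.
move=> su cu [x1 x2] [y1 y2]; rewrite /inDL /= => Dx + e; rewrite -{}e => Dy.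
apply: (@horocycle_constant _ q (fun z => u (z, x2)) (- hor x2)) => //.
- move=> n c d y hy cd; have i1 := swap_subtrees_involution n q2 cd.
  have [tD tK tp] := DL_involution i1 (id_involution r).
  have inv := carried_invariant su (cu (absz n + c + d)%N) tD tK tp; apply: (inv _ (y, x2)).
    move=> [z1 z2] Dz /= nc; congr pair; apply: swap_subtrees_id nc => //.
      by apply: (cone_mono q2 _ (mem_cone (n, c) q2)) => /=; lia.
    by apply: (cone_mono q2 _ (mem_cone (n, d) q2)) => /=; lia.
  by rewrite /DLset /= /inDL /= hy addNr.
- by lia.
- by lia.
Qed.

(** The two levels are opposite and both at least -n, so both lie between -n and n, where a cone has
    finitely many vertices. *)
Lemma cone_prod_finite n : exists s : seq (vert * vert),
  forall x, inDL x -> cone q n x.1 -> cone r n x.2 -> x \in s.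
Proof.
pose levels := [seq k%:Z - n%:Z | k <- iota 0 (2 * n).+1].
pose verts s := [seq (m, c) | m <- levels, c <- iota 0 (s ^ (2 * n))].
have vertsP s m c : (2 <= s)%N -> cone s n (m, c) -> m <= n%:Z -> (m, c) \in verts s.
  move=> s2 /andP[/= h1 h2] h3; apply: allpairs_f.
    by apply/mapP; exists (absz (m + n%:Z)%R); rewrite ?mem_iota; lia.
  rewrite mem_iota /= add0n; apply: (leq_trans h2).
  by rewrite leq_exp2l//; lia.
exists [seq (x, y) | x <- verts q, y <- verts r] => [[[m c] [m' c']]] /=.
rewrite /inDL /hor /= => Dx cx cy; apply: allpairs_f; apply: vertsP => //.
  by case/andP: cy => /=; lia.
by case/andP: cx => /=; lia.
Qed.

Lemma DL_decomposition h : irreducible DLset p -> positive_harmonic DLset p h ->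
  exists a b, [/\ nonneg_harmonic DLset p a, nonneg_harmonic DLset p b,
    forall x, inDL x -> h x = a x + b x,
    forall x y, inDL x -> inDL y -> x.1 = y.1 -> a x = a y &
    forall x y, inDL x -> inDL y -> x.2 = y.2 -> b x = b y].
Proof.
move=> irr hh; have [p0 _] := tm.
have [|||n|a [b [ha hb hab ca cb]]] := @harmonic_decomposition R _ DLset p p0 h
  (fun n => [set x | ~~ cone r n x.2]) (fun n => [set x | ~~ cone q n x.1]) irr hh.
- by move=> m n mn x /=; apply: contra; exact: cone_mono.
- by move=> m n mn x /=; apply: contra; exact: cone_mono.
(* The second coordinate has level -(n+1), smaller than the level of the apex of the cone. *)
- move=> n; exists ((n.+1%:Z, 0%N), (- n.+1%:Z, 0%N)); split.
    by rewrite /DLset /= /inDL /hor /= subrr.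
  by rewrite /cone /=; lia.
- have [s sP] := cone_prod_finite n; exists s => x Dx /= h1 h2.
  by apply: sP => //; apply/negPn/negP.
exists a, b; split=> //.
- exact/cone_complement_invariant2/ca/harmonic_superharmonic.
- exact/cone_complement_invariant1/cb/harmonic_superharmonic.
Qed.

(** * Functions of one coordinate and the projected chain *)

Lemma esum_DL (F : vert * vert -> R) : (forall y, inDL y -> 0 <= F y) ->
  \esum_(y in DLset) (F y)%:E =
  \esum_(y1 in [set: vert]) \esum_(y2 in [set y2 | hor y1 + hor y2 = 0]) (F (y1, y2))%:E.
Proof.
move=> F0; rewrite esum_esum.
  rewrite (_ : _ `*`` _ = DLset); first by apply: eq_esum => -[].
  apply/seteqP; split=> [x [_ /= e]|x /eqP e]; last by [].
  by rewrite /DLset /= /inDL e.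
by move=> y1 y2 _ /= e; rewrite lee_fin F0// /inDL e.
Qed.

Definition base2 (x1 : vert) : vert * vert := (x1, (- hor x1, 0%N)).

Lemma inDL_base2 x1 : DLset (base2 x1).
Proof. by rewrite /DLset /= /inDL /hor /= subrr. Qed.

(** The sum is part of a row sum equal to 1, so it is finite and [fine] loses nothing. *)
Lemma proj1E x1 y1 : (proj1 p x1 y1)%:E =
  \esum_(y2 in [set y2 : vert | hor y1 + hor y2 = 0]) (p (base2 x1) (y1, y2))%:E.
Proof.
have [p0 p1] := tm; have Db := inDL_base2 x1.
have pos y : [set y2 : vert | hor y + hor y2 = 0] `<=`
  [set y2 | (0 <= (p (base2 x1) (y, y2))%:E)%E].
  by move=> y2 /= e; rewrite lee_fin p0// /DLset /= /inDL e.
rewrite /proj1 fineK// ge0_fin_numE; last by apply: esum_ge0; exact: pos.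
apply: (@le_lt_trans _ _ 1%E); last exact: ltry.
rewrite -(p1 _ Db) esum_DL; last by move=> y; exact: p0.
apply: esum_ge; exists [set y1]; first by split=> // _ ->.
by rewrite fsbig_set1.
Qed.

Lemma avg_proj1 f x1 : (forall y, 0 <= f y) ->
  avg setT (proj1 p) f x1 = avg DLset p (f \o fst) (base2 x1).
Proof.
move=> f0; have [p0 _] := tm; have Db := inDL_base2 x1.
rewrite /avg esum_DL => [|y Dy]; last by rewrite mulr_ge0 ?p0 /= ?f0.
apply: eq_esum => y1 _; rewrite mulrC EFinM proj1E -esumZl//.
by apply: eq_esum => y2 _; rewrite mulrC.
Qed.

(** Exchanges in the second tree preserve P and leave [f \o fst] unchanged, so the average does not
    see the second coordinate. *)
Lemma avg_lift f x : DLset x -> avg DLset p (f \o fst) x = avg DLset p (f \o fst) (base2 x.1).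
Proof.
case: x => x1 x2; rewrite /DLset /= /inDL /= => Dx.
apply: (@horocycle_constant _ r (fun z => avg DLset p (f \o fst) (x1, z)) (- hor x1)) => //.
  move=> n c d y hy cd; have i2 := swap_subtrees_involution n r2 cd.
  have [tD tK tp] := DL_involution (id_involution q) i2.
  rewrite /avg [LHS](esum_involution _ tD tK).
  apply: eq_esum => z Dz; rewrite -[in RHS]tp//.
  by rewrite /DLset /= /inDL /= hy subrr.
by lia.
Qed.

Lemma harmonic_proj1 f : nonneg_harmonic DLset p (f \o fst) <->
  nonneg_harmonic setT (proj1 p) f.
Proof.
split=> -[f0 fP].
  have {}f0 y : 0 <= f y by exact: (f0 (base2 y) (inDL_base2 y)).
  split=> // x _; rewrite -/(avg _ _ _ _) avg_proj1//.
  exact: (fP (base2 x) (inDL_base2 x)).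
split=> [x _|x Dx]; first exact: f0.
by rewrite -/(avg _ _ _ _) avg_lift// -avg_proj1 ?[LHS]fP// => y; exact: f0.
Qed.

End DiestelLeader.

(** * Minimal harmonic functions and their descent to a factor *)

Lemma eq_harmonic (R : realType) (V : choiceType) (S : set V) (p : V -> V -> R)
    (u w : V -> R) : (forall x, S x -> u x = w x) ->
  nonneg_harmonic S p u -> nonneg_harmonic S p w.
Proof.
move=> uw [u0 uP]; split=> x Sx; rewrite -uw//; first exact: u0.
by rewrite uP//; apply: eq_esum => y Sy; rewrite uw.
Qed.

(** Minimality speaks of strictly positive functions only; by irreducibility a non-negative harmonic
    function that vanishes at one point vanishes on [S], and then c = 0. *)
Lemma minimal_harmonic_le (R : realType) (V : choiceType) (S : set V)
    (p : V -> V -> R) (o : V) (h a : V -> R) : irreducible S p ->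
  minimal_harmonic S p o h -> nonneg_harmonic S p a ->
  (forall x, S x -> a x <= h x) -> exists c, forall x, S x -> a x = c * h x.
Proof.
move=> irr [_ _ hmin] ha ah; have [a0 _] := ha.
have [apos|] := pselect (forall x, S x -> 0 < a x); first exact: hmin.
move=> napos; exists 0 => x Sx; rewrite mul0r; apply/eqP; rewrite eq_le a0// andbT.
rewrite leNgt; apply/negP => ax; apply: napos => y Sy.
exact: (superharmonic_gt0 irr (harmonic_superharmonic ha) Sx ax).
Qed.

(** A competitor [g] of [f] lifts to the competitor [g \o pr] of [h]; the proportionality found
    there descends because every point of [V1] has a preimage in [S]. *)
Lemma minimal_harmonic_descend (R : realType) (V V1 : choiceType) (S : set V)
    (p : V -> V -> R) (p1 : V1 -> V1 -> R) (pr : V -> V1) (o : V)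
    (h : V -> R) (f : V1 -> R) :
  (forall g, nonneg_harmonic S p (g \o pr) <-> nonneg_harmonic setT p1 g) ->
  (forall x1, exists2 x, S x & pr x = x1) -> S o ->
  minimal_harmonic S p o h -> (forall x, S x -> h x = f (pr x)) ->
  minimal_harmonic setT p1 (pr o) f.
Proof.
move=> prP prS So [[hh hpos] ho hmin] hf; split.
- split; first by apply/prP; apply: eq_harmonic hh.
  by move=> x1 _; have [x Sx <-] := prS x1; rewrite -hf// hpos.
- by rewrite -hf.
- move=> g [hg gpos] gf.
  have [||c gc] := hmin (g \o pr).
  + by split; [apply/prP|move=> x Sx; exact: gpos].
  + by move=> x Sx; rewrite hf// gf.
  exists c => x1 _; have [x Sx <-] := prS x1.
  by rewrite -hf// -gc.
Qed.

(** * The second projection, by exchanging the two trees *)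

Section Projection2.
Variables (R : realType) (q r : nat) (p : vert * vert -> vert * vert -> R).
Hypotheses (q2 : (2 <= q)%N) (r2 : (2 <= r)%N).
Hypotheses (tm : transition_matrix DLset p) (si : semi_isotropic q r p).

Definition flip (x : vert * vert) := (x.2, x.1).

Lemma flipK : involutive flip. Proof. by case. Qed.

Lemma DLset_flip x : DLset x -> DLset (flip x).
Proof. by rewrite /DLset /= /inDL /= addrC. Qed.

Lemma esum_flip (F : vert * vert -> \bar R) :
  \esum_(x in DLset) F x = \esum_(x in DLset) F (flip x).
Proof. exact: esum_involution DLset_flip flipK. Qed.

Let p' x y := p (flip x) (flip y).

Lemma proj2_flip : proj2 p = proj1 p'.
Proof.
apply/funext => x; apply/funext => y; rewrite /proj1 /proj2 /p' /=; congr fine.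
by congr esum; apply/seteqP; split=> z /=; rewrite addrC.
Qed.

(** The matrix [p'] is semi-isotropic on DL(r,q), with the arguments of the measure exchanged in
    pairs, so the result for the first projection applies to it. *)
Lemma harmonic_proj2 f : nonneg_harmonic DLset p (f \o snd) <->
  nonneg_harmonic setT (proj2 p) f.
Proof.
have tm' : transition_matrix DLset p'.
  case: tm => p0 p1; split=> [x y Dx Dy|x Dx].
    by apply: p0; exact: DLset_flip.
  by rewrite -(p1 _ (DLset_flip Dx)) [RHS]esum_flip.
have si' : semi_isotropic r q p'.
  case: si => m [m0 [mz mP]]; exists (fun k1 l1 k2 l2 => m k2 l2 k1 l1); split=> //.
  split=> [k1 l1 k2 l2 kl|x y Dx Dy]; first by apply: mz; rewrite addnC [(l2 + _)%N]addnC.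
  by rewrite /p' mP//; exact: DLset_flip.
rewrite proj2_flip -(harmonic_proj1 r2 q2 tm' si').
split=> -[f0 fP]; split=> x Dx.
- exact: (f0 _ (DLset_flip Dx)).
- by rewrite (fP _ (DLset_flip Dx)) esum_flip.
- exact: (f0 _ (DLset_flip Dx)).
- rewrite (fP _ (DLset_flip Dx)) esum_flip; apply: eq_esum => -[y1 y2] _.
  by rewrite /p' flipK.
Qed.
End Projection2.

Theorem theorem3p3 (R : realType) (q r : nat)
  (p : vert * vert -> vert * vert -> R) :
  (2 <= q)%N -> (2 <= r)%N ->
  transition_matrix DLset p -> irreducible DLset p -> semi_isotropic q r p ->
  (* (a) *)
  (forall h : vert * vert -> R, minimal_harmonic DLset p DLroot h ->
     (exists h1 : vert -> R, minimal_harmonic setT (proj1 p) troot h1 /\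
        forall x, inDL x -> h x = h1 x.1) \/
     (exists h2 : vert -> R, minimal_harmonic setT (proj2 p) troot h2 /\
        forall x, inDL x -> h x = h2 x.2)) /\
  (* (b) *)
  (forall h : vert * vert -> R, positive_harmonic DLset p h ->
     exists (h1 h2 : vert -> R),
       [/\ nonneg_harmonic setT (proj1 p) h1, nonneg_harmonic setT (proj2 p) h2 &
           forall x, inDL x -> h x = h1 x.1 + h2 x.2]).
Proof.
move=> q2 r2 tm irr si.
have D1 x1 : DLset (x1, (- hor x1, 0%N)) by rewrite /DLset /= /inDL /hor /= subrr.
have D2 x2 : DLset ((- hor x2, 0%N), x2) by rewrite /DLset /= /inDL /hor /= addNr.
have partb h : positive_harmonic DLset p h -> exists (h1 h2 : vert -> R),
    [/\ nonneg_harmonic setT (proj1 p) h1, nonneg_harmonic setT (proj2 p) h2 &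
        forall x, inDL x -> h x = h1 x.1 + h2 x.2].
  move=> hh; have [a [b [ha hb hab a1 b2]]] := DL_decomposition q2 r2 tm si irr hh.
  pose h1 x1 := a (x1, (- hor x1, 0%N)); pose h2 x2 := b ((- hor x2, 0%N), x2).
  have ah1 x : inDL x -> a x = h1 x.1 by move=> Dx; apply: a1 => //; exact: D1.
  have bh2 x : inDL x -> b x = h2 x.2 by move=> Dx; apply: b2 => //; exact: D2.
  exists h1, h2; split.
  - by apply/(harmonic_proj1 q2 r2 tm si); apply: eq_harmonic ha.
  - by apply/(harmonic_proj2 q2 r2 tm si); apply: eq_harmonic hb.
  - by move=> x Dx; rewrite hab// ah1// bh2.
split=> // h hmin; have [hh _ _] := hmin; have [h1 [h2 [hh1 hh2 hE]]] := partb h hh.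
have h20 x : 0 <= h2 x by case: hh2 => + _; exact.
(* The summand depending on the first coordinate is harmonic and at most [h], hence equals c h. If c
   = 0, then [h] is the other summand; otherwise [h] is this one divided by c. *)
have [x Dx|c hc] := minimal_harmonic_le irr hmin
    ((harmonic_proj1 q2 r2 tm si h1).2 hh1).
  by rewrite hE//= lerDl.
have S1 x1 : exists2 x, DLset x & x.1 = x1 by exists (x1, (- hor x1, 0%N)); [exact: D1|].
have S2 x2 : exists2 x, DLset x & x.2 = x2 by exists ((- hor x2, 0%N), x2); [exact: D2|].
have Do : DLset DLroot by [].
have [c0|cn0] := eqVneq c 0.
  have e x : inDL x -> h x = h2 x.2.
    by move=> Dx; rewrite hE// (hc x Dx : h1 x.1 = _) c0 mul0r add0r.
  right; exists h2; split=> //.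
  exact: (minimal_harmonic_descend (harmonic_proj2 q2 r2 tm si) S2 Do hmin e).
have e x : inDL x -> h x = c^-1 * h1 x.1.
  by move=> Dx; rewrite (hc x Dx : h1 x.1 = _) mulKf.
left; exists (fun x1 => c^-1 * h1 x1); split=> //.
exact: (minimal_harmonic_descend (harmonic_proj1 q2 r2 tm si) S1 Do hmin e).
Qed.
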